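(* Let $S$ be a semiring that is multiplicatively generated by idempotents, and suppose that every idempotent in $S$ has a nilorthogonal complement. If $\mathcal{N}(S)\subseteq V(S)\cap Z(S)$, then $S$ is commutative (i.e. $ab=ba$ for all $a,b\in S$) and Boolean (i.e. $a^2=a$ for all $a\in S$).
   Context: A semiring is a set $S$ with binary operations $+$ and $\cdot$ such that $(S,+)$ is a commutative monoid with identity element $0$, $(S,\cdot)$ is a (not necessarily commutative) monoid with identity element $1$, multiplication distributes over addition on both sides, and $0\cdot a=a\cdot 0=0$ for all $a\in S$. An element $e\in S$ is idempotent if $e^2=e$. An element $x\in S$ is nilpotent if $x^k=0$ for some positive integer $k$; $\mathcal{N}(S)$ denotes the set of all nilpotent elements of $S$. An element $e\in S$ is nilidempotent if $e^2=e+x$ for some $x\in\mathcal{N}(S)$. $V(S)$ denotes the set of additively invertible elements of $S$, i.e. those $a\in S$ for which there is $b\in S$ with $a+b=0$. $Z(S)$ denotes the centre of $S$, i.e. the set of $a\in S$ with $ab=ba$ for all $b\in S$. The semiring $S$ is multiplicatively generated by idempotents if every element of $S$ is a finite product of idempotents of $S$. A nilidempotent $e\in S$ (in particular, an idempotent) has a nilorthogonal complement if there exist a nilidempotent $f\in S$ and a nilpotent $x\in S$ such that $e+f=1+x$ and $ef,fe\in\mathcal{N}(S)$. The semiring $S$ is Boolean if every element of $S$ is idempotent. *)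

(* Defs.v *)
(* [pzSemiRingType] (not [nzSemiRingType]): the trivial semiring, where 1 = 0, is
   allowed. *)
From mathcomp Require Import all_boot all_order all_algebra.

Set Implicit Arguments.
Unset Strict Implicit.
Unset Printing Implicit Defensive.

Import GRing.Theory.
Local Open Scope ring_scope.

Definition idempotent_elt (S : pzSemiRingType) (e : S) : Prop := e ^+ 2 = e.

Definition nilpotent_elt (S : pzSemiRingType) (x : S) : Prop :=
  exists k : nat, (0 < k)%N /\ x ^+ k = 0.

Definition nilidempotent (S : pzSemiRingType) (e : S) : Prop :=
  exists x : S, nilpotent_elt x /\ e ^+ 2 = e + x.

Definition add_invertible (S : pzSemiRingType) (a : S) : Prop :=
  exists b : S, a + b = 0.

Definition central_elt (S : pzSemiRingType) (a : S) : Prop :=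
  forall b : S, GRing.comm a b.

Definition idempotent_generated (S : pzSemiRingType) : Prop :=
  forall a : S, exists s : seq S,
    (forall e : S, e \in s -> idempotent_elt e) /\ a = \prod_(e <- s) e.

Definition has_nilorthogonal_complement (S : pzSemiRingType) (e : S) : Prop :=
  exists f x : S,
    [/\ nilidempotent f, nilpotent_elt x, e + f = 1 + x,
        nilpotent_elt (e * f) & nilpotent_elt (f * e)].

Definition boolean_semiring (S : pzSemiRingType) : Prop :=
  forall a : S, idempotent_elt a.

(* Main.v *)
(** If [e + f = 1 + x] is a nilorthogonal complement, subtracting [x] from [f]
    gives [g] with [e + g = 1] and [e * g], [g * e] additively invertible.
    Addition is not cancellative, so [e = e + e * g] does not force [e * g = 0];
    but multiplying it by [g] gives [e * g = e * g + e * g ^ 2], where [e * g]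
    can be cancelled.  Hence [h = g ^ 2] is a genuine orthogonal complement of [e].
    The corners [e * a * h] and [h * a * e] square to zero, hence are central,
    hence vanish, so idempotents are central; and a product of central
    idempotents is a central idempotent. *)
Require Import Defs.
From mathcomp Require Import all_boot all_order all_algebra.

Import GRing.Theory.
Local Open Scope ring_scope.

Section Semiring.

Variable S : pzSemiRingType.
Implicit Types a b e g h x : S.

Lemma add_invertibleD a b :
  add_invertible a -> add_invertible b -> add_invertible (a + b).
Proof.
by move=> [a' aa'] [b' bb']; exists (a' + b'); rewrite addrACA aa' bb' addr0.
Qed.

Lemma add_invertibleMl a x : add_invertible x -> add_invertible (a * x).
Proof. by move=> [x' xx']; exists (a * x'); rewrite -mulrDr xx' mulr0. Qed.

Lemma add_invertibleMr a x : add_invertible x -> add_invertible (x * a).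
Proof. by move=> [x' xx']; exists (x' * a); rewrite -mulrDl xx' mul0r. Qed.

Lemma add_invertible_cancel a b : add_invertible a -> a + b = a -> b = 0.
Proof. by move=> [a' aa'] ab; rewrite -[b]add0r -aa' addrAC ab. Qed.

Lemma orthogonal_complement_sqr e g :
    idempotent_elt e -> e + g = 1 ->
    add_invertible (e * g) -> add_invertible (g * e) ->
  [/\ e + g * g = 1, e * (g * g) = 0 & g * g * e = 0].
Proof.
rewrite /idempotent_elt expr2 => ee eg1 Veg Vge.
have e_eg : e + e * g = e by rewrite -{1}ee -mulrDr eg1 mulr1.
have e_ge : e + g * e = e by rewrite -{1}ee -mulrDl eg1 mul1r.
split.
(* Expanding [e] to [e + e * g] lets [e * g + g * g] collapse to [(e + g) * g = g]. *)
- by rewrite -{1}e_eg -addrA -mulrDl eg1 mul1r.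
- by apply: (add_invertible_cancel _ _ Veg); rewrite mulrA -mulrDl e_eg.
- by apply: (add_invertible_cancel _ _ Vge); rewrite -mulrA -mulrDr e_ge.
Qed.

Lemma central_corner_eq0 e h a :
    (forall x, nilpotent_elt x -> central_elt x) ->
    idempotent_elt e -> e * h = 0 -> h * e = 0 ->
  e * a * h = 0 /\ h * a * e = 0.
Proof.
rewrite /idempotent_elt expr2 => nilZ ee eh0 he0.
have Zeah : central_elt (e * a * h).
  apply: nilZ; exists 2; split=> //.
  by rewrite expr2 !mulrA -(mulrA (e * a) h e) he0 mulr0 !mul0r.
have Zhae : central_elt (h * a * e).
  apply: nilZ; exists 2; split=> //.
  by rewrite expr2 !mulrA -(mulrA (h * a) e h) eh0 mulr0 !mul0r.
split.
(* Commuting with [e] kills a corner: [e] fixes it on one side and annihilates it on the other. *)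
- by have := Zeah e; rewrite /GRing.comm !mulrA ee -mulrA he0 mulr0.
- by have := Zhae e; rewrite /GRing.comm !mulrA eh0 !mul0r -mulrA ee.
Qed.

Lemma idempotent_central e :
    has_nilorthogonal_complement e ->
    (forall x, nilpotent_elt x -> add_invertible x /\ central_elt x) ->
    idempotent_elt e ->
  central_elt e.
Proof.
move=> [f [x [_ Nx efx Nef Nfe]]] hnil ee a.
have nilV y (Ny : nilpotent_elt y) := (hnil y Ny).1.
have nilZ y (Ny : nilpotent_elt y) := (hnil y Ny).2.
have [x' xx'] := nilV x Nx.
have Vx' : add_invertible x' by exists x; rewrite addrC.
(* [f + x'] plays the role of [f - x]. Its products with [e] are a nilpotent plus a multiple of
   [x'], both additively invertible. *)
have [||| eh1 eh0 he0] := orthogonal_complement_sqr e (f + x') ee.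
- by rewrite addrA efx -addrA xx' addr0.
- rewrite mulrDr.
  exact: add_invertibleD _ _ (nilV _ Nef) (add_invertibleMl _ _ Vx').
- rewrite mulrDl.
  exact: add_invertibleD _ _ (nilV _ Nfe) (add_invertibleMr _ _ Vx').
have [eah0 hae0] := central_corner_eq0 _ _ a nilZ ee eh0 he0.
rewrite /GRing.comm.
(* Splitting [1 = e + h], with [h] the square of [f + x'], reduces both [e * a] and [a * e] to
   [e * a * e]. *)
have -> : e * a = e * a * e by rewrite -[LHS]mulr1 -eh1 mulrDr eah0 addr0.
by rewrite -[in RHS](mul1r (a * e)) -eh1 mulrDl !mulrA hae0 addr0.
Qed.

Lemma prod_central_idempotent (s : seq S) :
    (forall e, e \in s -> idempotent_elt e /\ central_elt e) ->
  idempotent_elt (\prod_(e <- s) e) /\ central_elt (\prod_(e <- s) e).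
Proof.
(* [big_seq] keeps the membership [e \in s] available for the factors in the induction. *)
move=> hs; rewrite big_seq.
elim/big_ind: _ => [|a b [aa Za] [bb Zb]|e /hs //].
  by split=> [|b]; [exact: expr1n | exact/commr_sym/commr1].
split=> [|c]; last exact/commr_sym/commrM/commr_sym/Zb/commr_sym/Za.
by rewrite /idempotent_elt exprMn_comm ?aa ?bb //; exact: Za.
Qed.

End Semiring.

Theorem corollary3p4 (S : pzSemiRingType)
    (hgen : idempotent_generated S)
    (hcompl : forall e : S, idempotent_elt e -> has_nilorthogonal_complement e)
    (hnil : forall x : S, nilpotent_elt x -> add_invertible x /\ central_elt x) :
  (forall a b : S, a * b = b * a) /\ boolean_semiring S.
Proof.
have all_central_idem (a : S) : idempotent_elt a /\ central_elt a.
  have [s [idem_s ->]] := hgen a; apply: prod_central_idempotent => e /idem_s ee.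
  by split=> //; apply: idempotent_central _ _ (hcompl e ee) hnil ee.
by split=> [a b|a]; have [aa Za] := all_central_idem a; [exact: Za | exact: aa].
Qed.
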